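(* Let $A,B\subseteq\mathbb{R}\setminus\{0\}$ be finite sets. Then $$|A+B|^3\gg \frac{|B|\,\mathsf{E}^*(A)}{\log|A|}\geq \frac{|A|^4|B|}{|AA^{\pm1}|\log|A|},$$ and $$|B+AA|^3\gg \frac{|B|\,|A|^{12}}{(\mathsf{E}^*_3(A))^2\,|AA^{-1}|\,\log|A|}.$$
   Context: $A+B=\{a+b:a\in A,b\in B\}$, $AA=\{ab:a,b\in A\}$, $AA^{-1}=\{a/b:a,b\in A\}$, and $|AA^{\pm1}|$ denotes either $|AA|$ or $|AA^{-1}|$ (the inequality holds for both); $B+AA=\{b+x:b\in B,x\in AA\}$. The multiplicative energy $\mathsf{E}^*(A)$ is the number of solutions of $a_1a_2=a_3a_4$ with $a_i\in A$. For $x\in\mathbb{R}$ let $r_{A:A}(x)=|\{(a,b)\in A\times A: a/b=x\}|$, and $\mathsf{E}^*_3(A)=\sum_x r_{A:A}(x)^3$. $X\gg Y$ means $X\geq cY$ for an absolute constant $c>0$. Logarithms are base 2. *)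

(* Defs.v *)
From HB Require Import structures.
From Stdlib Require Import Reals.
From mathcomp Require Import all_boot all_order all_algebra.
From mathcomp Require Import finmap.
From mathcomp Require Import Rstruct.
Set Implicit Arguments. Unset Strict Implicit. Unset Printing Implicit Defensive.
Import Order.TTheory GRing.Theory Num.Theory.
Local Open Scope fset_scope.
Local Open Scope ring_scope.

Notation Rl := Rdefinitions.R.

Definition sumset (A B : {fset Rl}) : {fset Rl} := [fset a + b | a in A, b in B].
Definition prodset (A : {fset Rl}) : {fset Rl} := [fset a * b | a in A, b in A].
Definition quotset (A : {fset Rl}) : {fset Rl} := [fset a / b | a in A, b in A].

Definition mult_energy (A : {fset Rl}) : nat :=
  (\sum_(a1 <- A) \sum_(a2 <- A) \sum_(a3 <- A) \sum_(a4 <- A)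
     ((a1 * a2)%R == (a3 * a4)%R : bool))%N.

Definition r_ratio (A : {fset Rl}) (x : Rl) : nat :=
  (\sum_(a <- A) \sum_(b <- A) ((a / b)%R == x : bool))%N.

(* E^*_3(A) = sum_x r_{A:A}(x)^3; r vanishes outside A A^{-1}, so the sum is finite *)
Definition mult_energy3 (A : {fset Rl}) : nat :=
  (\sum_(x <- quotset A) (r_ratio A x) ^ 3)%N.

Definition log2 (x : Rl) : Rl := Rdiv (Rpower.ln x) (Rpower.ln 2%R).

(* Main.v *)
Require Import Defs.
From HB Require Import structures.
From Stdlib Require Import Reals.
From mathcomp Require Import all_boot all_order all_algebra.
From mathcomp Require Import finmap zify lra ring.
From mathcomp Require Import Rstruct.
Import Order.TTheory GRing.Theory Num.Theory.
Local Open Scope fset_scope.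
Local Open Scope ring_scope.
Set Implicit Arguments. Unset Strict Implicit. Unset Printing Implicit Defensive.

(** Let [C = A + B] and let [S] be a set of slopes [s], each with at least [t] points
    of [A * A] on the line [y = s x]. The lines of slope in [S] through the points of
    [B * B] are [t]-rich in the grid [C * C], so there are [L << |C|^4 / t^3] of them,
    while they have [|S| |B|^2] incidences with [B * B]; bounding these incidences by
    Szemeredi-Trotter as well gives [|S| t^2 |B| << |C|^3] as soon as [t |B| > |C|],
    and otherwise the same follows from [|S| t <= |A|^2]. Summing over dyadic [t]
    yields the bound on the energy. For Cartesian products Szemeredi-Trotter has an
    elementary proof: cut the grid into cells of [M * M] points; a line meets few
    cells, and two points of a common cell lie on only one line.

    The second inequality is the first one for [AA], with
    [E(AA) >= |A|^12 / (E_3(A)^2 |A/A|)] obtained from two applications of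
    Cauchy-Schwarz. *)

(** * Counting by fibres and Cauchy-Schwarz *)

Lemma sum_nat_count (T : Type) (p : pred T) (s : seq T) :
  (\sum_(x <- s) p x = count p s)%N.
Proof. by rewrite -sum1_count [RHS]big_mkcond; apply: eq_bigr => x _; case: (p x). Qed.

Lemma sum_nat_const_seq (T : Type) (s : seq T) (k : nat) :
  (\sum_(x <- s) k = size s * k)%N.
Proof. by rewrite big_const_seq count_predT iter_addn_0 mulnC. Qed.

Lemma count_le1 (T : eqType) (p : pred T) (s : seq T) : uniq s ->
  {in s &, forall x y, p x -> p y -> x = y} -> (count p s <= 1)%N.
Proof.
move=> us inj; rewrite -size_filter.
case E: [seq x <- s | p x] => [|x [|y r]] //.
have /= := filter_uniq p us; rewrite E /= inE negb_or => /andP[/andP[/eqP nxy _] _].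
have hx : x \in [seq x <- s | p x] by rewrite E !inE eqxx.
have hy : y \in [seq x <- s | p x] by rewrite E !inE eqxx orbT.
move: hx hy; rewrite !mem_filter => /andP[px sx] /andP[py sy].
by case: nxy; apply: inj.
Qed.

Lemma sum_eq_mem (T : eqType) (s : seq T) (y : T) (F : T -> nat) : uniq s ->
  (\sum_(x <- s) (x == y) * F x = (y \in s) * F y)%N.
Proof.
move=> us; case: (boolP (y \in s)) => ys.
  rewrite (bigD1_seq y) //= eqxx big1 ?addn0 // => x /negPf->; by rewrite mul0n.
rewrite big1_seq // => x /andP[_ xs]; case: eqP => [e|//].
by move: ys; rewrite -e xs.
Qed.

Lemma sum_fibers (I T : eqType) (s : seq I) (f : I -> T) (Y : seq T) :
  uniq Y -> {in s, forall i, f i \in Y} ->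
  (\sum_(y <- Y) \sum_(i <- s) (f i == y) = size s)%N.
Proof.
move=> uY fY; rewrite exchange_big /= -sum1_size big_seq [RHS]big_seq.
apply: eq_bigr => i si; transitivity ((f i \in Y) * 1)%N; last by rewrite fY.
rewrite -(sum_eq_mem _ (fun=> 1%N)) //; apply: eq_bigr => y _; by rewrite muln1 eq_sym.
Qed.

(** Expanding the squares counts pairs with equal values. [Y] may miss values of [f], hence the
    factor [f i \in Y]; this generality serves for the ratios of [AA] that lie in [A/A]. *)
Lemma sum_fibers_sqr (I T : eqType) (s : seq I) (f : I -> T) (Y : seq T) :
  uniq Y ->
  (\sum_(y <- Y) (\sum_(i <- s) (f i == y)) ^ 2
   = \sum_(i <- s) (f i \in Y) * \sum_(j <- s) (f i == f j))%N.
Proof.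
move=> uY.
transitivity (\sum_(y <- Y) \sum_(i <- s) \sum_(j <- s) (y == f i) * (y == f j))%N.
  apply: eq_bigr => y _; rewrite expnS expn1 big_distrl /=; apply: eq_bigr => i _.
  rewrite big_distrr /=; apply: eq_bigr => j _; by rewrite ![y == _]eq_sym.
rewrite exchange_big /=; apply: eq_bigr => i _.
rewrite exchange_big big_distrr /=; apply: eq_bigr => j _.
by rewrite (sum_eq_mem _ (fun y => y == f j : nat)).
Qed.

Lemma sum_collisions (I T : eqType) (s : seq I) (f : I -> T) (Y : seq T) :
  uniq Y -> {in s, forall i, f i \in Y} ->
  (\sum_(i <- s) \sum_(j <- s) (f i == f j)
   = \sum_(y <- Y) (\sum_(i <- s) (f i == y)) ^ 2)%N.
Proof.
move=> uY fY; rewrite sum_fibers_sqr // big_seq [RHS]big_seq.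
by apply: eq_bigr => i /fY->; rewrite mul1n.
Qed.

Lemma sum_sqr_le (T : Type) (s : seq T) (F : T -> nat) :
  ((\sum_(x <- s) F x) ^ 2 <= size s * \sum_(x <- s) F x ^ 2)%N.
Proof.
elim: s => [|x s IH]; first by rewrite !big_nil.
rewrite !big_cons /=.
have: (2 * F x * \sum_(y <- s) F y <= size s * F x ^ 2 + \sum_(y <- s) F y ^ 2)%N.
  elim: s {IH} => [|y s IH]; first by rewrite !big_nil muln0.
  rewrite !big_cons /= mulnDr mulSn; have [] := nat_Cauchy (F x) (F y).
  rewrite !expnS !expn0 !muln1 in IH *. nia.
move: IH; rewrite !expnS !expn0 !muln1 => IH H. nia.
Qed.

Lemma size_sqr_le_collisions (I T : eqType) (s : seq I) (f : I -> T) (Y : seq T) :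
  uniq Y -> {in s, forall i, f i \in Y} ->
  (size s ^ 2 <= size Y * \sum_(i <- s) \sum_(j <- s) (f i == f j))%N.
Proof.
move=> uY fY; rewrite -(sum_fibers uY fY) (sum_collisions uY fY).
exact: sum_sqr_le.
Qed.

(** A fibre of size [u] satisfies [2 u <= 1 + u ^ 2]. Sum over the [K] possible values and remove
    the diagonal pairs. *)
Lemma size_le_collisions (T : eqType) (s : seq T) (f : T -> nat) (K : nat) :
  uniq s -> {in s, forall x, f x < K}%N ->
  (size s <= K + \sum_(x <- s) \sum_(y <- s) ((x != y) && (f x == f y)))%N.
Proof.
move=> us fK.
have fY : {in s, forall x, f x \in iota 0 K} by move=> x /fK; rewrite mem_iota.
have e1 := sum_fibers (iota_uniq 0 K) fY.
have e2 := esym (sum_collisions (iota_uniq 0 K) fY).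
have h : (2 * size s <= K + \sum_(x <- s) \sum_(y <- s) (f x == f y))%N.
  apply: (@leq_trans (\sum_(k <- iota 0 K) (1 + (\sum_(x <- s) (f x == k)) ^ 2))%N).
    rewrite -e1 big_distrr /=; apply: leq_sum => k _; set u := (\sum_(_ <- _) _)%N; nia.
  by rewrite big_split /= sum1_size size_iota e2.
have: (\sum_(x <- s) \sum_(y <- s) (f x == f y) =
  size s + \sum_(x <- s) \sum_(y <- s) ((x != y) && (f x == f y)))%N.
  rewrite -sum1_size -big_split /= big_seq [RHS]big_seq; apply: eq_bigr => x xs.
  have -> : 1%N = (\sum_(y <- s) (y == x) * 1)%N by rewrite sum_eq_mem // xs.
  rewrite -big_split /=; apply: eq_bigr => y _.
  by rewrite muln1 (eq_sym y); case: (x =P y) => [->|_] //=; rewrite eqxx.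
lia.
Qed.

(** * Incidences of lines with a Cartesian square *)

Section Grid.
Variables (R : realFieldType) (X : {fset R}) (M : nat).
Local Notation n := #|` X|.

(** Cells are blocks of [M] consecutive ranks, so for [M > 0] each holds at most [M] points of [X],
    however [X] is spaced. *)
Definition cell (x : R) : nat := count (fun z => z < x) X %/ M.

Lemma cell_le (x y : R) : x <= y -> (cell x <= cell y)%N.
Proof.
by move=> xy; apply/leq_div2r/sub_count => z /= zx; apply: lt_le_trans xy.
Qed.

Lemma cell_max (x : R) : (cell x <= n %/ M)%N.
Proof. by apply: leq_div2r; apply: count_size. Qed.

Lemma count_cell (q : nat) : (0 < M)%N -> (\sum_(x <- X) (q == cell x) <= M)%N.
Proof.
move=> M0; rewrite sum_nat_count -size_filter.
pose rk (x : R) := count (fun z => z < x) X.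
have rk_lt x y : x \in X -> x < y -> (rk x < rk y)%N.
  move=> xX xy; rewrite /rk -!size_filter.
  apply: (@leq_trans (size (x :: [seq z <- X | z < x]))) => //; apply: uniq_leq_size.
    by rewrite /= filter_uniq ?fset_uniq // mem_filter ltxx.
  move=> z; rewrite inE !mem_filter => /predU1P[->|/andP[zx ->]]; first by rewrite xy.
  by rewrite (lt_trans zx xy).
rewrite -(size_iota (q * M) M) -(size_map rk); apply: uniq_leq_size.
  rewrite map_inj_in_uniq ?filter_uniq ?fset_uniq // => x y.
  rewrite !mem_filter => /andP[_ xX] /andP[_ yX] e.
  by case: (ltgtP x y) => // h; [have := rk_lt _ _ xX h|have := rk_lt _ _ yX h]; rewrite e ltnn.
move=> _ /mapP[x /[!mem_filter]/andP[/eqP qx _] ->]; rewrite mem_iota.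
have := divn_eq (rk x) M; have := ltn_pmod (rk x) M0; rewrite qx /cell -/(rk x); lia.
Qed.

Definition on_line (l : R * R) (x : R) : R := l.1 * x + l.2.

(** Lines are pairs (slope, intercept), hence never vertical, and a point of the grid on a given
    line is determined by its abscissa. *)
Definition incidences (L : {fset R * R}) : nat :=
  (\sum_(l <- L) count (fun x => on_line l x \in X) X)%N.

Definition close_pairs (l : R * R) : nat :=
  (\sum_(x <- X) \sum_(y <- X) [&& x != y, cell x == cell y,
     on_line l x \in X, on_line l y \in X & cell (on_line l x) == cell (on_line l y)])%N.

(* A line is monotone, so the sum or difference of the two coordinates of a cell
   separates the cells met by the line. *)
Lemma count_on_line (l : R * R) : l.1 != 0 ->
  (count (fun x => on_line l x \in X) X <= 2 * (n %/ M).+1 + close_pairs l)%N.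
Proof.
move=> l0; rewrite -size_filter; set s := filter _ _.
pose f x := (cell x + (if (0 < l.1)%R then cell (on_line l x)
                       else n %/ M - cell (on_line l x)))%N.
have fP x y : x <= y -> f x = f y -> cell x = cell y /\ cell (on_line l x) = cell (on_line l y).
  move=> xy; have := cell_le xy.
  have := cell_max (on_line l x); have := cell_max (on_line l y).
  rewrite /f; case: ltP => [lp|ln].
    have : on_line l x <= on_line l y by rewrite lerD2r ler_pM2l.
    move=> /cell_le; lia.
  have : on_line l y <= on_line l x by rewrite lerD2r ler_wnM2l.
  move=> /cell_le; lia.
have us : uniq s by rewrite filter_uniq ?fset_uniq.
have fK : {in s, forall x, f x < 2 * (n %/ M).+1}%N.
  move=> x _; rewrite /f; have := cell_max x; have := cell_max (on_line l x); case: ifP; lia.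
apply: leq_trans (size_le_collisions us fK) _; rewrite leq_add2l.
rewrite big_filter big_mkcond /=; apply: leq_sum => x _.
case: ifP => // lx; rewrite big_filter big_mkcond /=; apply: leq_sum => y _.
case: ifP => // ly; case: eqP => //= nxy; case: eqP => // e.
suff [-> ->] : cell x = cell y /\ cell (on_line l x) = cell (on_line l y) by rewrite !eqxx.
by case: (lerP x y) => [/fP /(_ e)|/ltW/fP/(_ (esym e)) []].
Qed.

(** Two distinct points lie on at most one line, so the sum is at most the number of pairs of grid
    points in a common cell: [n M] pairs of abscissae times [n M] pairs of ordinates. *)
Lemma sum_close_pairs (L : {fset R * R}) : (0 < M)%N ->
  (\sum_(l <- L) close_pairs l <= (n * M) ^ 2)%N.
Proof.
move=> M0; rewrite exchange_big /=.
have sum_cells : (\sum_(x <- X) \sum_(y <- X) (cell x == cell y) <= n * M)%N.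
  rewrite -sum1_size big_distrl /=; apply: leq_sum => x _; rewrite mul1n; exact: count_cell.
apply: (@leq_trans (\sum_(x <- X) \sum_(y <- X) (cell x == cell y) * (n * M))); last first.
  rewrite expnS expn1; under eq_bigr do rewrite -big_distrl /=.
  by rewrite -big_distrl leq_mul2r sum_cells orbT.
apply: leq_sum => x _; rewrite exchange_big /=; apply: leq_sum => y _.
case: (x =P y) => [_|/eqP nxy] /=; first by rewrite big1.
case: eqP => [_|_] /=; last by rewrite big1.
rewrite mul1n; apply: leq_trans sum_cells.
(* The ordinates [z] and [w] become summation variables, so that the sum over lines can be taken for
   two fixed points. *)
apply: (@leq_trans (\sum_(l <- L) \sum_(z <- X) (z == on_line l x) *
   (\sum_(w <- X) (w == on_line l y) * (cell z == cell w)))%N).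
  apply: leq_sum => l _; rewrite !sum_eq_mem ?fset_uniq //.
  by case: (_ \in _) => //=; case: (_ \in _) => //=; case: eqP.
rewrite exchange_big /=; apply: leq_sum => z _.
under eq_bigr do rewrite big_distrr /=.
rewrite exchange_big /=; apply: leq_sum => w _.
under eq_bigr do rewrite mulnA.
rewrite -big_distrl /= -[leqRHS]mul1n leq_mul2r; apply/orP; right.
under eq_bigr do rewrite mulnb.
rewrite sum_nat_count; apply: count_le1; first exact: fset_uniq.
move=> -[s c] [s' c'] _ _ /=.
rewrite /on_line /= => /andP[/eqP -> /eqP ->] /andP[/eqP e1 /eqP e2].
have : (s - s') * (x - y) == 0 by rewrite mulrBl; apply/eqP; lra.
rewrite mulf_eq0 !subr_eq0 (negPf nxy) orbF => /eqP es.
by rewrite es in e1 *; congr (_, _); lra.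
Qed.

Lemma incidences_le (L : {fset R * R}) : (0 < M)%N -> {in L, forall l, l.1 != 0} ->
  (incidences L <= 2 * (n %/ M).+1 * #|` L| + (n * M) ^ 2)%N.
Proof.
move=> M0 L0.
apply: leq_trans (leq_add (leqnn _) (sum_close_pairs L M0)).
rewrite mulnC -sum1_size big_distrl -big_split /= /incidences big_seq [leqRHS]big_seq.
by apply: leq_sum => l /L0 l0; rewrite mul1n count_on_line.
Qed.

End Grid.

(** * Choice of the cell sizes *)

Lemma half_sqr_approx (k : nat) : (2 <= k)%N ->
  exists2 M, (0 < M)%N & (2 * M ^ 2 <= k)%N && (k <= 8 * M ^ 2)%N.
Proof.
move=> k2; pose P M := (2 * M ^ 2 <= k)%N.
have exP : exists M, P M by exists 1%N.
have bP M : P M -> (M <= k)%N by rewrite /P; nia.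
case: (ex_maxnP exP bP) => M PM maxM; have M1 := maxM 1%N k2.
exists M => //; move: (PM); rewrite /P => -> /=.
(* Maximality gives [k < 2 (M + 1) ^ 2], which is at most [8 M ^ 2] as [M >= 1]. *)
have : ~~ P M.+1 by apply/negP => /maxM; rewrite ltnn.
rewrite /P; nia.
Qed.

Section IncidenceArithmetic.
Variables (N t s b L : nat).

(** Here [N = |C|] and [L] is the number of [t]-rich lines. With [M] about [8 N / t] the cells
    crossed account for at most 3/8 of [t L], so the pair term dominates; [t M <= 9 N] then gives
    the constant [2 * 9 ^ 2]. *)
Lemma rich_lines_bound : (16 < t)%N -> (t <= N)%N ->
  (forall M, 0 < M -> t * L <= 2 * (N %/ M).+1 * L + (N * M) ^ 2)%N ->
  (t ^ 3 * L <= 162 * N ^ 4)%N.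
Proof.
move=> t16 tN; pose M := (8 * N %/ t).+1 => /(_ M isT) H.
have tM : (t * M <= 9 * N)%N by have := leq_trunc_div (8 * N) t; rewrite /M; nia.
have NM : (8 * (N %/ M) <= t)%N.
  have lt : (8 * N < t * M)%N by rewrite (mulnC t) ltn_ceil //; lia.
  have := leq_trunc_div N M; have M0 : (0 < M)%N by [].
  move=> q; rewrite -(leq_pmul2r M0); lia.
have h : (t * L <= 2 * (N * M) ^ 2)%N.
  (* The rounding term is absorbed by [t > 16]: [2 t + 16 <= 3 t]. *)
  have h1 : (2 * (N %/ M).+1 * L * 8 <= 3 * t * L)%N.
    rewrite mulnAC leq_mul2r; apply/orP; right; lia.
  lia.
have e : (t ^ 3 * L <= 2 * (N * (t * M)) ^ 2)%N.
  apply: (@leq_trans (t ^ 2 * (2 * (N * M) ^ 2))); first by rewrite expnSr -mulnA leq_mul2l h orbT.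
  by apply: eq_leq; ring.
apply: leq_trans e _; apply: (@leq_trans (2 * (N * (9 * N)) ^ 2)).
  by rewrite leq_mul2l /= leq_exp2r // leq_mul2l tM orbT.
by apply: eq_leq; ring.
Qed.

(** Here [s = |S|] and [b = |B|]. Taking [M ^ 2] of order [s] with [2 M ^ 2 <= s] keeps the pair
    term below half of [s b ^ 2], whence [s b ^ 2 <= 4 (b / M + 1) L], and the bound on [L]
    applies. *)
Lemma slope_count_bound : (b <= N)%N -> (N < t * b)%N ->
  (2 <= s)%N -> (t ^ 3 * L <= 162 * N ^ 4)%N ->
  (forall M, 0 < M -> s * b ^ 2 <= 2 * (b %/ M).+1 * L + (b * M) ^ 2)%N ->
  (s * t ^ 2 * b <= 648 * N ^ 3)%N.
Proof.
move=> bN Ntb s2 tL H; have [M M0 /andP[Ms sM]] := half_sqr_approx s2.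
have {H} : (s * b ^ 2 <= 4 * (b %/ M).+1 * L)%N.
  have := H _ M0; have : (2 * (b * M) ^ 2 <= s * b ^ 2)%N.
    by rewrite expnMn mulnCA mulnC leq_mul2r Ms orbT.
  lia.
(* If [b < M], then [s b ^ 2 <= 4 L]; multiplying by [t ^ 3] and using [N < t b] yields the constant
   [4 * 162 = 648]. *)
case: (posnP (b %/ M)) => [->|q0] H.
  have N0 : (0 < N)%N by case: (N) bN Ntb => //; case: (b) => //; rewrite muln0.
  rewrite -(leq_pmul2l N0); apply: (@leq_trans (t * b * (s * t ^ 2 * b))).
    by rewrite leq_mul2r (ltnW Ntb) orbT.
  apply: (@leq_trans (t ^ 3 * (s * b ^ 2))); first by apply: eq_leq; ring.
  apply: (@leq_trans (t ^ 3 * (4 * L))); first by rewrite leq_mul2l; apply/orP; right; lia.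
  apply: (@leq_trans (4 * (162 * N ^ 4))); first by rewrite mulnCA leq_mul2l tL orbT.
  by apply: eq_leq; ring.
have b0 : (0 < b)%N by case: (b) q0 => //; rewrite div0n.
have {H q0} : (M * b * s <= 8 * L)%N.
  rewrite -(leq_pmul2r b0); apply: (@leq_trans (M * (s * b ^ 2))); first by apply: eq_leq; ring.
  apply: (@leq_trans (M * (8 * (b %/ M) * L))).
    rewrite leq_mul2l; apply/orP; right; apply: leq_trans H _; rewrite leq_mul2r; lia.
  apply: (@leq_trans (8 * L * (b %/ M * M))); first by apply: eq_leq; ring.
  by rewrite leq_mul2l leq_trunc_div orbT.
rewrite -(@leq_exp2r _ _ 2) // => H.
(* Squaring [M b s <= 8 L] lets [s <= 8 M ^ 2] eliminate [M]. *)
have {}H : (b ^ 2 * s ^ 3 <= 512 * L ^ 2)%N.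
  apply: (@leq_trans (b ^ 2 * s ^ 2 * (8 * M ^ 2))).
    by rewrite (expnSr s) mulnA leq_mul2l sM orbT.
  apply: (@leq_trans (8 * (M * b * s) ^ 2)); first by apply: eq_leq; ring.
  apply: (@leq_trans (8 * (8 * L) ^ 2)); first by rewrite leq_mul2l H orbT.
  by apply: eq_leq; ring.
rewrite -(@leq_exp2r _ _ 3) //.
apply: (@leq_trans (b ^ 2 * s ^ 3 * t ^ 6 * b)); first by apply: eq_leq; ring.
apply: (@leq_trans (512 * L ^ 2 * t ^ 6 * N)).
  by apply: leq_mul => //; rewrite leq_mul2r H orbT.
apply: (@leq_trans (512 * (t ^ 3 * L) ^ 2 * N)); first by apply: eq_leq; ring.
apply: (@leq_trans (512 * (162 * N ^ 4) ^ 2 * N)).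
  by rewrite leq_mul2r leq_mul2l leq_exp2r // tL !orbT.
apply: (@leq_trans (512 * 162 ^ 2 * N ^ 9)); first by apply: eq_leq; ring.
(* Since [162 ^ 2 <= 30 ^ 3], the constant is below the cube of [8 * 30 = 240]. *)
apply: (@leq_trans (512 * 30 ^ 3 * N ^ 9)); first by rewrite leq_mul2r leq_mul2l /= orbT.
apply: (@leq_trans ((8 * 30 * N ^ 3) ^ 3)); first by apply: eq_leq; ring.
by rewrite leq_exp2r // leq_mul2r orbT.
Qed.

End IncidenceArithmetic.

(** * Slopes of rich lines through the origin *)

Section RichSlopes.
Variables (R : realFieldType) (A B C : {fset R}).
Hypothesis A0 : 0 \notin A.
Hypothesis ABC : forall a b, a \in A -> b \in B -> a + b \in C.

Definition dilate_count (s : R) : nat := count (fun a => s * a \in A) A.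

Definition lines_through (S : {fset R}) : {fset R * R} :=
  [fset (s, p.2 - s * p.1) | s in S, p in B `*` B]%fset.

(** A triple [(s, b, b')] is recovered from the incidence of its line with the point [(b, b')]. *)
Lemma incidences_lines_through (S : {fset R}) :
  (#|` S| * #|` B| ^ 2 <= incidences B (lines_through S))%N.
Proof.
pose triples := [seq (s, p) | s <- S, p <- [seq (b, b') | b <- B, b' <- B]].
pose incs := [seq (l, b) | l <- lines_through S, b <- [seq b <- B | on_line l b \in B]].
have -> : (#|` S| * #|` B| ^ 2 = size triples)%N by rewrite !size_allpairs expnS expn1.
have -> : incidences B (lines_through S) = size incs.
  rewrite size_allpairs_dep sumnE big_map; apply: eq_bigr => l _.
  by rewrite size_filter.
pose g (u : R * (R * R)) := ((u.1, u.2.2 - u.1 * u.2.1), u.2.1).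
rewrite -(size_map g); apply: uniq_leq_size.
  rewrite map_inj_uniq.
    by do 2?[apply: allpairs_uniq => //; last by move=> [? ?] [? ?] _ _ [-> ->]].
  by move=> [s [b b']] [u [d d']] [<- e bd]; rewrite -bd in e *; rewrite (addIr _ e).
move=> _ /mapP[_ /allpairsP[[s p] /= [sS /allpairsP[[b b'] /= [bB b'B ->]] ->]] ->].
rewrite /g /=; apply/allpairsPdep.
exists (s, b' - s * b), b; split => //.
  by apply/imfset2P; exists s => //; exists (b, b') => //; rewrite ?inE /= ?in_fsetM /= bB.
by rewrite mem_filter /on_line /= addrC subrK b'B.
Qed.

(** Translation by a point of [B * B] carries the points of [A * A] on [y = s x] to points of
    [C * C] on the parallel line. *)
Lemma lines_through_rich (S : {fset R}) (l : R * R) : l \in lines_through S ->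
  (dilate_count l.1 <= count (fun x => on_line l x \in C) C)%N.
Proof.
move=> /imfset2P[s /= _ [[b b']]]; rewrite ?inE /= ?in_fsetM /= => /andP[bB b'B] -> /=.
rewrite /dilate_count -!size_filter -(size_map (fun a => a + b)); apply: uniq_leq_size.
  by rewrite map_inj_uniq ?filter_uniq ?fset_uniq //; apply: addIr.
move=> _ /mapP[a /[!mem_filter]/andP[saA aA] ->]; rewrite (ABC aA bB) andbT.
have -> : on_line (s, b' - s * b) (a + b) = s * a + b' by rewrite /on_line /=; ring.
exact: ABC.
Qed.

(** Lines through the origin with distinct slopes share only the origin, which is not in [A * A]. *)
Lemma sum_dilate_count_le (S : {fset R}) :
  (\sum_(s <- S) dilate_count s <= #|` A| ^ 2)%N.
Proof.
under eq_bigr do rewrite /dilate_count -sum_nat_count.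
rewrite exchange_big /= expnS expn1 -[leqRHS]sum_nat_const_seq.
rewrite big_seq [leqRHS]big_seq; apply: leq_sum => a aA; rewrite sum_nat_count -size_filter.
rewrite -(size_map (fun s => s * a) [seq _ <- S | _]); apply: uniq_leq_size.
  rewrite map_inj_uniq ?filter_uniq ?fset_uniq //; apply: mulIf.
  by apply: contraNneq A0 => <-.
by move=> _ /mapP[s /[!mem_filter]/andP[saA _] ->].
Qed.

Lemma leq_card_translate (X : {fset R}) (y : R) :
  {in X, forall x, x + y \in C} -> (#|` X| <= #|` C|)%N.
Proof.
move=> XC; rewrite -(size_map (fun x => x + y)); apply: uniq_leq_size.
  by rewrite map_inj_uniq ?fset_uniq //; apply: addIr.
by move=> _ /mapP[x xX ->]; apply: XC.
Qed.

Lemma rich_slopes (S : {fset R}) (t : nat) :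
  {in S, forall s, s != 0 /\ (t <= dilate_count s)%N} ->
  (#|` S| * t ^ 2 * #|` B| <= 648 * #|` C| ^ 3)%N.
Proof.
move=> HS.
case: (fset_0Vmem S) => [->|[s0 s0S]]; first by rewrite cardfs0 !mul0n.
case: (fset_0Vmem B) => [->|[b0 b0B]]; first by rewrite cardfs0 muln0.
case: (posnP t) => [->|t0]; first by rewrite exp0n // muln0.
have [_ ts0] := HS _ s0S.
have /hasP[a0 a0A _] : has (fun a => s0 * a \in A) A.
  by rewrite has_count (leq_trans t0 ts0).
have AC : (#|` A| <= #|` C|)%N by apply: (@leq_card_translate _ b0) => a aA; apply: ABC.
have BC : (#|` B| <= #|` C|)%N.
  by apply: (@leq_card_translate _ a0) => b bB; rewrite addrC; apply: ABC.
have tC : (t <= #|` C|)%N by apply: leq_trans AC; apply: leq_trans ts0 (count_size _ _).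
have StA : (#|` S| * t <= #|` C| ^ 2)%N.
  apply: (@leq_trans (#|` A| ^ 2)); last by rewrite leq_exp2r.
  apply: leq_trans (sum_dilate_count_le S).
  rewrite -sum1_size big_distrl /= big_seq [leqRHS]big_seq.
  by apply: leq_sum => s /HS[_]; rewrite mul1n.
(* This settles [t <= 16] and [t |B| <= |C|], the ranges outside the incidence argument. *)
have trivial_case (K : nat) : (t * #|` B| <= K * #|` C|)%N -> (K <= 648)%N ->
  (#|` S| * t ^ 2 * #|` B| <= 648 * #|` C| ^ 3)%N.
  move=> tB K648; apply: (@leq_trans (#|` S| * t * (t * #|` B|))).
    by apply: eq_leq; ring.
  apply: leq_trans (leq_mul StA tB) _.
  rewrite mulnCA -expnSr leq_mul2r K648 orbT //.
case: (leqP t 16) => [t16|t16].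
  by apply: (trivial_case 16) => //; apply: leq_mul.
case: (leqP (t * #|` B|) #|` C|) => [tB|tB].
  by apply: (trivial_case 1%N) => //; rewrite mul1n.
(* A cell size [M >= 1] with [2 M ^ 2 <= |S|] requires two slopes; for a single one, [t] and [|B|]
   are at most [|C|]. *)
case: (leqP 2 #|` S|) => [S2|S1]; last first.
  apply: (@leq_trans (1 * #|` C| ^ 2 * #|` C|)).
    by rewrite !leq_mul // leq_exp2r.
  by rewrite mul1n -expnSr leq_pmull.
pose L := lines_through S.
have L0 : {in L, forall l, l.1 != 0}.
  by move=> _ /imfset2P[s /= sS [p _ ->]] /=; have [] := HS _ sS.
apply: (@slope_count_bound _ _ _ _ #|` L|) => //.
  apply: rich_lines_bound => // M M0.
  apply: leq_trans (incidences_le C M0 L0).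
  rewrite mulnC -sum1_size big_distrl /= /incidences big_seq [leqRHS]big_seq.
  apply: leq_sum => l lL; rewrite mul1n; apply: leq_trans (lines_through_rich lL).
  by move: lL => /imfset2P[s /= sS [p _ ->]] /=; have [] := HS _ sS.
move=> M M0; exact: leq_trans (incidences_lines_through S) (incidences_le B M0 L0).
Qed.

End RichSlopes.

(** * Multiplicative energy and ratio counts *)

Section Energy.
Variable A : {fset Rl}.
Hypothesis A0 : 0 \notin A.

Local Notation pairs := [seq (a, b) | a <- A, b <- A].

Lemma neq0_mem (a : Rl) : a \in A -> a != 0.
Proof. by move=> aA; apply: contraNneq A0 => <-. Qed.

Lemma mem_quotset (a b : Rl) : a \in A -> b \in A -> a / b \in quotset A.
Proof. by move=> aA bA; apply/imfset2P; exists a => //; exists b. Qed.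

Lemma mem_prodset (a b : Rl) : a \in A -> b \in A -> a * b \in prodset A.
Proof. by move=> aA bA; apply/imfset2P; exists a => //; exists b. Qed.

Lemma quotset_neq0 (x : Rl) : x \in quotset A -> x != 0.
Proof.
by case/imfset2P => a /= aA [b bA ->]; rewrite mulf_neq0 ?invr_eq0 ?neq0_mem.
Qed.

Lemma prodset_neq0 : 0 \notin prodset A.
Proof.
apply/imfset2P => -[a /= aA [b bA /esym/eqP]].
by rewrite mulf_eq0 (negPf (neq0_mem aA)) (negPf (neq0_mem bA)).
Qed.

Lemma r_ratioE (x : Rl) : r_ratio A x = dilate_count A x.
Proof.
rewrite /r_ratio exchange_big /= /dilate_count -sum_nat_count.
rewrite big_seq [RHS]big_seq; apply: eq_bigr => b bA.
rewrite -[RHS]muln1 -(sum_eq_mem _ (fun=> 1%N)) ?fset_uniq //; apply: eq_bigr => a _.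
rewrite muln1; congr nat_of_bool.
by apply/eqP/eqP => [<-|->]; rewrite ?divfK ?mulfK // neq0_mem.
Qed.

Lemma r_ratio_pairs (x : Rl) : r_ratio A x = (\sum_(p <- pairs) (p.1 / p.2 == x)%R)%N.
Proof. by rewrite big_allpairs. Qed.

(** The equation [a1 a2 = a3 a4] is read as [a1 / a3 = a4 / a2]. *)
Lemma mult_energy_ratios :
  mult_energy A = (\sum_(p <- pairs) \sum_(q <- pairs) (p.1 / p.2 == q.1 / q.2)%R)%N.
Proof.
rewrite big_allpairs /mult_energy big_seq [RHS]big_seq; apply: eq_bigr => a aA /=.
rewrite exchange_big big_seq [RHS]big_seq; apply: eq_bigr => b bA /=.
rewrite big_allpairs exchange_big; apply: eq_bigr => c _ /=.
rewrite big_seq [RHS]big_seq; apply: eq_bigr => d dA; congr nat_of_bool.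
by rewrite eqr_div ?neq0_mem // [c * b]mulrC.
Qed.

Lemma mult_energyE : mult_energy A = (\sum_(x <- quotset A) r_ratio A x ^ 2)%N.
Proof.
rewrite mult_energy_ratios (sum_collisions (fset_uniq (quotset A))).
  by apply: eq_bigr => x _; rewrite r_ratio_pairs.
by move=> _ /allpairsP[[a b] /= [aA bA ->]]; apply: mem_quotset.
Qed.

(** Cauchy-Schwarz for the product map on [A * A], whose collisions are the energy. *)
Lemma card_prodset_mult_energy :
  (#|` A| ^ 4 <= #|` prodset A| * mult_energy A)%N.
Proof.
have : {in pairs, forall p, p.1 * p.2 \in prodset A}.
  by move=> _ /allpairsP[[a b] /= [aA bA ->]]; apply: mem_prodset.
move/(size_sqr_le_collisions (fset_uniq _)).
rewrite size_allpairs mulnn -expnM big_allpairs.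
by under eq_bigr do under eq_bigr do rewrite big_allpairs.
Qed.

Lemma card_quotset_mult_energy :
  (#|` A| ^ 4 <= #|` quotset A| * mult_energy A)%N.
Proof.
have : {in pairs, forall p, p.1 / p.2 \in quotset A}.
  by move=> _ /allpairsP[[a b] /= [aA bA ->]]; apply: mem_quotset.
move/(size_sqr_le_collisions (fset_uniq _)).
by rewrite size_allpairs mulnn -expnM mult_energy_ratios.
Qed.

End Energy.

(** * The third energy and the energy of the product set *)

Section Energy3.
Variable A : {fset Rl}.
Hypothesis A0 : 0 \notin A.

Local Notation pairs := [seq (a, b) | a <- A, b <- A].

(** One of the three factors of the cube is spent on summing over pairs [(a, b)] instead of
    ratios. *)
Lemma mult_energy3E :
  mult_energy3 A = (\sum_(a <- A) \sum_(b <- A) r_ratio A (a / b)%R ^ 2)%N.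
Proof.
transitivity (\sum_(x <- quotset A) \sum_(a <- A) \sum_(b <- A)
    (x == a / b)%R * r_ratio A x ^ 2)%N.
  apply: eq_bigr => x _; rewrite expnS big_distrl /=; apply: eq_bigr => a _.
  by rewrite big_distrl /=; apply: eq_bigr => b _; rewrite eq_sym.
rewrite exchange_big big_seq [RHS]big_seq; apply: eq_bigr => a aA.
rewrite exchange_big big_seq [RHS]big_seq; apply: eq_bigr => b bA.
by rewrite (sum_eq_mem _ (fun x => r_ratio A x ^ 2)%N) ?fset_uniq // mem_quotset // mul1n.
Qed.

(* Cauchy-Schwarz for the map [(a, c, d) |-> (c / d, a d)]: its collisions force
   [a / a' = d' / d = c' / c] and are thus counted by the third energy, while every
   value [(x, p)] satisfies [p \in AA] and [x p \in AA]. *)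
Lemma card_mult_energy3_prodset :
  (#|` A| ^ 6 <= (\sum_(x <- quotset A) r_ratio (prodset A) x) * mult_energy3 A)%N.
Proof.
pose P := prodset A.
pose s : seq (Rl * (Rl * Rl)) := [seq (a, p) | a <- A, p <- pairs].
pose f (u : Rl * (Rl * Rl)) := (u.2.1 / u.2.2, u.1 * u.2.2).
pose Y := [seq (x, p) | x <- quotset A, p <- [seq p <- P | x * p \in P]].
have uY : uniq Y.
  apply: allpairs_uniq_dep; rewrite ?fset_uniq //.
    by move=> x _; rewrite filter_uniq ?fset_uniq.
  by move=> [? ?] [? ?] _ _ [-> ->].
have fY : {in s, forall u, f u \in Y}.
  move=> _ /allpairsP[[a p] /= [aA /allpairsP[[c d] /= [cA dA ->]] ->]].
  apply/allpairsPdep; exists (c / d), (a * d); split => //; first exact: mem_quotset.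
  have e : c / d * (a * d) = a * c by rewrite mulrCA divfK ?(neq0_mem A0).
  by rewrite mem_filter e !mem_prodset.
have := size_sqr_le_collisions uY fY.
have -> : size s = (#|` A| ^ 3)%N by rewrite !size_allpairs.
have -> : size Y = (\sum_(x <- quotset A) r_ratio P x)%N.
  rewrite size_allpairs_dep sumnE big_map; apply: eq_bigr => x _.
  by rewrite size_filter (r_ratioE (prodset_neq0 A0)).
rewrite -expnM => /leq_trans; apply; rewrite leq_mul2l mult_energy3E; apply/orP; right.
rewrite big_allpairs big_seq [leqRHS]big_seq; apply: leq_sum => a aA.
have -> : (\sum_(p <- pairs) \sum_(v <- s) (f (a, p) == f v) =
  \sum_(b <- A) \sum_(p <- pairs) \sum_(q <- pairs) (f (a, p) == f (b, q)))%N.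
  rewrite [RHS]exchange_big /=; apply: eq_bigr => p _; by rewrite [LHS]big_allpairs.
rewrite big_seq [leqRHS]big_seq; apply: leq_sum => b bA.
(* From here [(c, d)] goes with [b] and [(c', d')] with [a]; the two factors of the square count
   [c / c' = a / b] and [d / d' = a / b]. *)
rewrite [leqRHS]expnS expn1 /r_ratio exchange_big big_distrl [leqLHS]big_allpairs /=.
rewrite big_seq [leqRHS]big_seq; apply: leq_sum => c cA.
under [leqLHS]eq_bigr do rewrite big_allpairs.
rewrite exchange_big big_distrl big_seq [leqRHS]big_seq; apply: leq_sum => c' c'A /=.
rewrite big_distrr big_seq [leqRHS]big_seq; apply: leq_sum => d dA /=.
rewrite big_distrr big_seq [leqRHS]big_seq; apply: leq_sum => d' d'A /=.
case: eqP => // -[/eqP]; rewrite !eqr_div ?(neq0_mem A0) // => /eqP e1 e2.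
have -> : d * b == a * d' by rewrite e2 mulrC.
suff -> : c * b == a * c' by [].
apply/eqP/(mulIf (neq0_mem A0 d'A)).
by rewrite mulrAC -e1 [RHS]mulrAC e2; ring.
Qed.

Lemma mult_energy_prodset_ge :
  (#|` A| ^ 12 <= mult_energy3 A ^ 2 * #|` quotset A| * mult_energy (prodset A))%N.
Proof.
pose P := prodset A.
rewrite (expnM _ 6 2).
apply: (@leq_trans (((\sum_(x <- quotset A) r_ratio P x) * mult_energy3 A) ^ 2)).
  by rewrite leq_exp2r // card_mult_energy3_prodset.
rewrite expnMn mulnC -mulnA leq_mul2l; apply/orP; right.
apply: leq_trans (sum_sqr_le _ _) _; rewrite leq_mul2l; apply/orP; right.
(* After Cauchy-Schwarz over [A/A], the squares of the ratio counts of [AA] at these [x] form only a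
   part of its energy. *)
under eq_bigr do rewrite r_ratio_pairs.
rewrite sum_fibers_sqr ?fset_uniq // mult_energy_ratios ?prodset_neq0 //.
by apply: leq_sum => p _; case: (_ \in _); rewrite ?mul1n.
Qed.

End Energy3.

(** * Dyadic summation over the level sets of the ratio count *)

Section Dyadic.
Variables A B : {fset Rl}.
Hypothesis A0 : 0 \notin A.

Lemma mult_energy_le :
  (#|` B| * mult_energy A <= 2592 * (trunc_log 2 #|` A|).+1 * #|` sumset A B| ^ 3)%N.
Proof.
set k := (trunc_log 2 _).+1.
pose S j := [fset x in quotset A | (2 ^ j <= r_ratio A x < 2 ^ j.+1)%N]%fset.
have SP j x : x \in S j = (x \in quotset A) && (2 ^ j <= r_ratio A x < 2 ^ j.+1)%N.
  by rewrite !inE.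
(* On a level the count is bounded above by [2 ^ j.+1] while the richness is [2 ^ j]; this loses a
   factor 4, and [2592 = 4 * 648]. *)
have hS j : (#|` B| * (#|` S j| * (2 ^ j.+1) ^ 2) <= 2592 * #|` sumset A B| ^ 3)%N.
  apply: (@leq_trans (4 * (#|` S j| * (2 ^ j) ^ 2 * #|` B|))).
    by apply: eq_leq; rewrite (expnS 2 j); ring.
  rewrite -[2592%N]/(4 * 648)%N -[leqRHS]mulnA leq_mul2l /=.
  apply: (rich_slopes A0).
    by move=> a b aA bB; apply/imfset2P; exists a => //; exists b.
  move=> x; rewrite SP => /andP[xQ /andP[rx _]].
  by rewrite (quotset_neq0 A0 xQ) -r_ratioE.
apply: (@leq_trans (\sum_(j < k) #|` B| * (#|` S j| * (2 ^ j.+1) ^ 2))); last first.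
  apply: (@leq_trans (\sum_(j < k) 2592 * #|` sumset A B| ^ 3)).
    by apply: leq_sum => j _; apply: hS.
  by apply: eq_leq; rewrite sum_nat_const card_ord; ring.
rewrite -big_distrr leq_mul2l mult_energyE //; apply/orP; right.
apply: (@leq_trans (\sum_(j < k) \sum_(x <- quotset A) (x \in S j) * (2 ^ j.+1) ^ 2)); last first.
  apply: leq_sum => j _; rewrite -big_distrl leq_mul2r /= sum_nat_count -size_filter.
  apply/orP; right; apply: uniq_leq_size; first by rewrite filter_uniq ?fset_uniq.
  by move=> x; rewrite mem_filter => /andP[].
rewrite exchange_big big_seq [leqRHS]big_seq; apply: leq_sum => x xQ /=.
case: (posnP (r_ratio A x)) => [->|r0] //.
have rA : (r_ratio A x <= #|` A|)%N by rewrite r_ratioE // count_size.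
have jk : (trunc_log 2 (r_ratio A x) < k)%N by rewrite ltnS leq_trunc_log.
rewrite (bigD1 (Ordinal jk)) //= SP xQ /= trunc_logP // trunc_log_ltn // mul1n.
by apply: leq_trans (leq_addr _ _); rewrite leq_exp2r // ltnW // trunc_log_ltn.
Qed.

End Dyadic.

(** * Size of the product set and binary logarithms *)

Lemma card_prodset_le (A : {fset Rl}) : (#|` prodset A| <= #|` A| ^ 2)%N.
Proof.
rewrite expnS expn1 -(size_allpairs (fun a b : Rl => a * b)).
apply: uniq_leq_size => // x /imfset2P[a /= aA [b bA ->]].
by apply/allpairsP; exists (a, b).
Qed.

Lemma ln2_gt0 : 0 < Rpower.ln 2 :> Rl.
Proof.
have <- : Rpower.ln 1 = 0 :> Rl by exact: Rpower.ln_1.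
by apply/RltP; apply: Rpower.ln_increasing; apply/RltP;
  rewrite ?ltr01 ?(ltr1n _ 2).
Qed.

Lemma log2M (x y : Rl) : 0 < x -> 0 < y -> log2 (x * y) = log2 x + log2 y.
Proof.
move=> /RltP x0 /RltP y0; rewrite /log2 (Rpower.ln_mult _ _ x0 y0).
by rewrite !RdivE RplusE mulrDl.
Qed.

Lemma log2_exp2 (k : nat) : log2 (2 ^+ k) = k%:R.
Proof.
elim: k => [|k IH]; first by rewrite expr0 /log2 Rpower.ln_1 RdivE mul0r.
rewrite exprS log2M ?exprn_gt0 // IH /log2 RdivE divff ?gt_eqF ?ln2_gt0 //.
by rewrite -natr1 addrC.
Qed.

Lemma log2_le (x y : Rl) : 0 < x -> x <= y -> log2 x <= log2 y.
Proof.
move=> /RltP x0; rewrite le_eqVlt => /predU1P[-> //|/RltP xy].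
rewrite /log2 !RdivE ler_pM2r ?invr_gt0 ?ln2_gt0 //.
by apply/ltW/RltP; apply: Rpower.ln_increasing.
Qed.

Lemma trunc_log_le_log2 (n : nat) : (0 < n)%N -> (trunc_log 2 n)%:R <= log2 n%:R.
Proof.
move=> n0; rewrite -(log2_exp2 (trunc_log 2 n)); apply: log2_le; rewrite ?exprn_gt0 //.
by rewrite -natrX ler_nat trunc_logP.
Qed.

(** * From the energy bounds to the real inequalities *)

Theorem theorem2p12 :
  exists c : Rl, 0 < c /\
  forall A B : {fset Rl},
    (0 \notin A) -> (0 \notin B) -> (2 <= #|` A|)%N ->
    let nA := (#|` A|)%:R : Rl in
    let nB := (#|` B|)%:R : Rl in
    let E := (mult_energy A)%:R : Rl in
    let E3 := (mult_energy3 A)%:R : Rl in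
    [/\ c * (nB * E / log2 nA) <= (#|` sumset A B|)%:R ^+ 3,
        nA ^+ 4 * nB / ((#|` prodset A|)%:R * log2 nA) <= nB * E / log2 nA,
        nA ^+ 4 * nB / ((#|` quotset A|)%:R * log2 nA) <= nB * E / log2 nA
      & c * (nB * nA ^+ 12 / (E3 ^+ 2 * (#|` quotset A|)%:R * log2 nA))
          <= (#|` sumset B (prodset A)|)%:R ^+ 3].
Proof.
pose K : Rl := 2592%:R.
have K0 : 0 < K by rewrite ltr0n.
(* [K] comes from the dyadic bound; for a set of at most [|A| ^ 2] elements the number of levels is
   at most [2 l + 1 <= 3 l], where [l = log2 nA >= 1]. *)
exists (K * 3)^-1; split; first by rewrite invr_gt0 mulr_gt0.
move=> A B A0 _ A2 nA nB E E3.
have n0 : (0 < #|` A|)%N by apply: ltnW.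
have nA0 : 0 < nA by rewrite ltr0n.
set l := log2 nA.
have l1 : 1 <= l by rewrite -[1](log2_exp2 1) log2_le // expr1 ler_nat.
have l0 : 0 < l by apply: lt_le_trans l1.
(* Serves both [P = A] and [P = AA], always with the logarithm of [|A|]. *)
have sum_bound (P : {fset Rl}) : 0 \notin P -> (#|` P| <= #|` A| ^ 2)%N ->
  nB * (mult_energy P)%:R / l <= K * 3 * (#|` sumset P B|)%:R ^+ 3.
  move=> P0 PA; rewrite ler_pdivrMr //.
  have : nB * (mult_energy P)%:R <=
      K * (trunc_log 2 #|` P|).+1%:R * (#|` sumset P B|)%:R ^+ 3.
    by rewrite -!natrM -natrX -natrM ler_nat; apply: mult_energy_le.
  move/le_trans; apply.
  rewrite [leRHS]mulrAC ler_wpM2r ?exprn_ge0 ?ler0n //.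
  rewrite -mulrA ler_pM2l // -natr1.
  have : (trunc_log 2 #|` P|)%:R <= l + l.
    have -> : l + l = log2 (#|` A| ^ 2)%:R by rewrite natrX expr2 log2M.
    apply: le_trans (trunc_log_le_log2 _); last by rewrite expn_gt0 n0.
    by rewrite ler_nat leq_trunc_log.
  by lra.
have ratio_bound (m : nat) : (#|` A| ^ 4 <= m * mult_energy A)%N ->
  nA ^+ 4 * nB / (m%:R * l) <= nB * E / l.
  move=> h; have m0 : 0 < m%:R :> Rl.
    by rewrite ltr0n; case: m h => //; rewrite mul0n leqn0 expn_eq0 -leqn0 leqNgt n0.
  rewrite invfM mulrA ler_pM2r ?invr_gt0 // ler_pdivrMr // -[leRHS]mulrA [leLHS]mulrC.
  by rewrite ler_wpM2l ?ler0n // mulrC -natrX -natrM ler_nat.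
split.
- rewrite mulrC ler_pdivrMr ?mulr_gt0 // [leRHS]mulrC; apply: sum_bound => //.
  by rewrite expnS expn1 leq_pmulr.
- exact: ratio_bound (card_prodset_mult_energy A).
- exact: ratio_bound (card_quotset_mult_energy A0).
have sumsetC : sumset B (prodset A) = sumset (prodset A) B.
  by apply/fsetP => x; apply/imfset2P/imfset2P => -[y yP [z zP ->]];
    exists z => //; exists y => //; rewrite addrC.
rewrite sumsetC mulrC ler_pdivrMr ?mulr_gt0 // [leRHS]mulrC.
apply: le_trans (sum_bound _ (prodset_neq0 A0) (card_prodset_le A)).
have h := mult_energy_prodset_ge A0.
set m := (mult_energy3 A ^ 2 * #|` quotset A|)%N in h.
(* The denominator is nonzero, since [h] bounds [|A| ^ 12 > 0] by a multiple of [m]. *)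
have m0 : 0 < m%:R :> Rl.
  rewrite ltr0n lt0n; apply: contraTneq h => ->.
  by rewrite mul0n leqn0 expn_eq0 -leqn0 leqNgt n0.
have -> : E3 ^+ 2 * (#|` quotset A|)%:R = m%:R by rewrite natrM natrX.
rewrite invfM mulrA ler_pM2r ?invr_gt0 // ler_pdivrMr // -[leRHS]mulrA.
by rewrite ler_wpM2l ?ler0n // mulrC -natrX -natrM ler_nat.
Qed.
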